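(* Let $\rho_1,\rho_2$ be density matrices of ranks $r_1,r_2$ with a priori probabilities $p_1,p_2$ ($p_1,p_2\ge 0$, $p_1+p_2=1$), with supports $\mathcal S_{\rho_1},\mathcal S_{\rho_2}$, on the Hilbert space $\mathcal H=\mathcal S_{\rho_1}+\mathcal S_{\rho_2}$. Suppose $\mathcal S_{\rho_1}\cap\mathcal S_{\rho_2}=\{0\}$. Put $$\mathcal S_1^\perp:=\mathcal S_{\rho_1}^{\perp}\cap\mathcal S_{\rho_2},\qquad \mathcal S_2^\perp:=\mathcal S_{\rho_2}^{\perp}\cap\mathcal S_{\rho_1}.$$ Then $\mathcal S_1^\perp$ and $\mathcal S_2^\perp$ are mutually orthogonal, so there is an orthogonal decomposition $\mathcal H=\mathcal H'\oplus\mathcal H'^{\perp}$ with $\mathcal H'^{\perp}=\mathcal S_1^\perp\oplus\mathcal S_2^\perp$. Let $\Pi_{\mathcal S_1^\perp},\Pi_{\mathcal S_2^\perp},\Pi_{\mathcal H'}$ be the orthogonal projections onto $\mathcal S_1^\perp,\mathcal S_2^\perp,\mathcal H'$. Put $N_i=\mathrm{Tr}(\rho_i\Pi_{\mathcal H'})$ for $i=1,2$, assume $N_1,N_2>0$, let $N=N_1p_1+N_2p_2$, and define the reduced problem on $\mathcal H'$ by $$\rho_i'=\frac1{N_i}\Pi_{\mathcal H'}\rho_i\Pi_{\mathcal H'},\qquad p_i'=\frac{N_ip_i}{N}\qquad(i=1,2).$$ Then a solution of the optimal unambiguous state discrimination problem for $(\rho_1,\rho_2;p_1,p_2)$ on $\mathcal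 H$ is given by $$F_1=F_1'+\Pi_{\mathcal S_2^\perp},\qquad F_2=F_2'+\Pi_{\mathcal S_1^\perp},\qquad F_?=F_?',$$ where $\{F_?',F_1',F_2'\}$ is any POVM on $\mathcal H'$ (its elements being extended by $0$ on $\mathcal H'^\perp$) that is an optimal unambiguous state discrimination measurement for $(\rho_1',\rho_2';p_1',p_2')$ on $\mathcal H'$. Moreover, the corresponding failure probabilities satisfy $$Q[\{F_k\}]=N\,Q'[\{F_k'\}],$$ where $Q'$ denotes the failure probability for the reduced problem.
   Context: All Hilbert spaces are finite-dimensional and complex. A density matrix is a positive semi-definite Hermitian operator of trace $1$. The support $\mathcal S_P$ of a positive semi-definite Hermitian operator $P$ is the span of its eigenvectors with non-zero eigenvalues. For a subspace $\mathcal S_{\rho_i}$ of $\mathcal H$, $\mathcal S_{\rho_i}^\perp$ denotes its orthogonal complement in $\mathcal H$. (The symbols $\mathcal S_1^\perp,\mathcal S_2^\perp$ are just names for the subspaces defined in the claim.) A POVM on a Hilbert space $\mathcal H$ is a family $\{F_k\}$ of positive semi-definite Hermitian operators on $\mathcal H$ with $\sum_kF_k=\mathbb 1_{\mathcal H}$. An unambiguous state discrimination measurement (USDM) on $\mathcal H$ for density matrices $\rho_1,\rho_2$ is a POVM $\{F_?,F_1,F_2\}$ on $\mathcal H$ with $\mathrm{Tr}(\rho_1F_2)=0=\mathrm{Tr}(\rho_2F_1)$. Given a priori probabilities $p_1,p_2$, its failure probability is $Q[\{F_k\}]=p_1\mathrm{Tr}(\rho_1F_?)+p_2\mathrm{Tr}(\rho_2F_?)$.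 A USDM is optimal (a solution of the optimal unambiguous state discrimination problem) if its failure probability is minimal among all USDMs for $\rho_1,\rho_2$ on $\mathcal H$. *)

(* Defs.v *)
From HB Require Import structures.
From mathcomp Require Import all_boot all_order all_algebra spectral sesquilinear.
From mathcomp Require Import complex reals.

Set Implicit Arguments.
Unset Strict Implicit.
Unset Printing Implicit Defensive.

Import Order.TTheory GRing.Theory Num.Theory.
Local Open Scope ring_scope.

(* The ambient Hilbert space is the space of row vectors 'rV[C]_n with the
   inner product dotmx; an operator A acts on it by u |-> u *m A, and a subspace
   is the row space of a matrix, as in mxalgebra and spectral.  In the order of
   a numClosedFieldType, 0 <= x says that x is real and non-negative. *)

(* Orthogonal complement for dotmx; spectral only has it as a local notation. *)
Notation "B ^!" :=
  (orthomx Num.conj (mx_of_hermitian (hermitian1mx _)) B%MS) : matrix_set_scope.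

Section Discrimination.
Variables (C : numClosedFieldType) (n : nat).
Implicit Types (A F rho : 'M[C]_n) (p : C).

Definition psdmx A : Prop :=
  A \is hermsymmx /\ forall u : 'rV[C]_n, 0 <= dotmx (u *m A) u.

Definition density A : Prop := psdmx A /\ \tr A = 1.

(* spectral_diag A lists the eigenvalues of A when A is Hermitian (it is a junk
   value when A is not normal). *)
Definition supportmx A : 'M[C]_n :=
  (\sum_(i < n | spectral_diag A 0 i != 0)
     eigenspace A (spectral_diag A 0 i))%MS.

(* A maps W into W and vanishes on W^!: these matrices are the operators on the
   Hilbert space W, extended by 0 to the ambient space.  The identity operator
   of W is then proj_ortho W. *)
Definition operator_on m (W : 'M[C]_(m, n)) A : Prop :=
  proj_ortho W *m A *m proj_ortho W = A.

Definition povm m (W : 'M[C]_(m, n)) (Fs : seq 'M[C]_n) : Prop :=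
  (forall F, F \in Fs -> operator_on W F /\ psdmx F) /\
  \sum_(F <- Fs) F = proj_ortho W.

(* Fq is the operator of the inconclusive outcome "?". *)
Definition usdm m (W : 'M[C]_(m, n)) rho1 rho2 Fq F1 F2 : Prop :=
  [/\ povm W [:: Fq; F1; F2], \tr (rho1 *m F2) = 0 & \tr (rho2 *m F1) = 0].

Definition failure rho1 rho2 p1 p2 Fq : C :=
  p1 * \tr (rho1 *m Fq) + p2 * \tr (rho2 *m Fq).

Definition optimal_usdm m (W : 'M[C]_(m, n)) rho1 rho2 p1 p2 Fq F1 F2 : Prop :=
  usdm W rho1 rho2 Fq F1 F2 /\
  forall Gq G1 G2, usdm W rho1 rho2 Gq G1 G2 ->
    failure rho1 rho2 p1 p2 Fq <= failure rho1 rho2 p1 p2 Gq.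

End Discrimination.

(* Main.v *)
(* Let P1, P2 be the projections onto S1, S2.  In a USDM (G?, G1, G2) positivity
   forces rho1 G2 = rho2 G1 = 0, hence P1 G1 = P2 G2 = 0, hence P1 G? P2 = 0.
   The generalized Schur complement G?' of G? with respect to S1 + S2 is then
   G? - D1 - D2, with D1 and D2 the contributions of S1 and S2, and
   G1' = G1 - P2 + D2, G2' = G2 - P1 + D1 turn out to be positive operators on H'
   that complete G?' to a USDM for the reduced problem.  As G?' <= G?, the failure
   probability has not increased, so minimizing over USDMs on H' is enough. *)
Require Import Defs.
From HB Require Import structures.
From mathcomp Require Import all_boot all_order all_algebra spectral sesquilinear.
From mathcomp Require Import complex reals.
From mathcomp Require Import ring.

Set Implicit Arguments.
Unset Strict Implicit.
Unset Printing Implicit Defensive.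

Import Order.TTheory GRing.Theory Num.Theory.
Local Open Scope ring_scope.

(** * Adjoints, Hilbert-Schmidt norm and positive semi-definite matrices *)

Section PositiveMatrices.
Local Open Scope sesquilinear_scope.
Variables (C : numClosedFieldType) (n : nat).
Implicit Types (A B D E F P X rho : 'M[C]_n).

Lemma adjmxM m p q (A : 'M[C]_(m, p)) (B : 'M_(p, q)) :
  (A *m B)^t* = B^t* *m A^t*.
Proof. by rewrite trmx_mul map_mxM. Qed.

Lemma adjmxD m p (A B : 'M[C]_(m, p)) : (A + B)^t* = A^t* + B^t*.
Proof. by rewrite linearD map_mxD. Qed.

Lemma adjmxB m p (A B : 'M[C]_(m, p)) : (A - B)^t* = A^t* - B^t*.
Proof. by rewrite linearB map_mxB. Qed.

Lemma hermsymmxP A : reflect (A^t* = A) (A \is hermsymmx).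
Proof.
apply: (iffP (is_hermitianmxP _ _ _)); rewrite expr0 scale1r.
  by move=> <-.
by move=> ->.
Qed.

(** The squared Hilbert-Schmidt norm: its positivity and definiteness drive all the trace arguments
    below. *)
Lemma mxtrace_mul_adj m p (A : 'M[C]_(m, p)) :
  \tr (A *m A^t*) = \sum_i \sum_j `|A i j| ^+ 2.
Proof.
apply: eq_bigr => i _; rewrite mxE; apply: eq_bigr => j _.
by rewrite !mxE normCK.
Qed.

Lemma mxtrace_mul_adj_ge0 m p (A : 'M[C]_(m, p)) : 0 <= \tr (A *m A^t*).
Proof.
rewrite mxtrace_mul_adj; apply: sumr_ge0 => i _; apply: sumr_ge0 => j _.
exact: exprn_ge0.
Qed.

Lemma mxtrace_mul_adj_eq0 m p (A : 'M[C]_(m, p)) :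
  \tr (A *m A^t*) = 0 -> A = 0.
Proof.
rewrite mxtrace_mul_adj => A0; apply/matrixP => i j; rewrite mxE.
have row_ge0 k : true -> 0 <= \sum_j `|A k j| ^+ 2.
  by move=> _; apply: sumr_ge0 => l _; exact: exprn_ge0.
have rowi0 : \sum_l `|A i l| ^+ 2 = 0 by exact: (psumr_eq0P row_ge0 A0).
have /eqP : `|A i j| ^+ 2 = 0.
  by apply: (psumr_eq0P _ rowi0) => // l _; exact: exprn_ge0.
by rewrite expf_eq0 normr_eq0 => /eqP.
Qed.

Lemma psdmx_mul_adj m (B : 'M[C]_(n, m)) : psdmx (B *m B^t*).
Proof.
split; first by apply/hermsymmxP; rewrite adjmxM trmxCK.
move=> u; rewrite dotmxE mulmxA -mulmxA -adjmxM -trace_mx11.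
exact: mxtrace_mul_adj_ge0.
Qed.

Lemma psdmx_sqrt A : psdmx A -> exists B, A = B *m B^t*.
Proof.
case=> hA A_ge0; have /orthomx_spectralP := hermitian_normalmx hA.
set U := spectralmx A; set d := spectral_diag A => defA.
have uU : U \is unitarymx := spectral_unitarymx A.
rewrite invmx_unitary // in defA.
have d_ge0 i : 0 <= d 0 i.
  (* An eigenvalue is the value of the quadratic form of [A] at the unit eigenvector [row i U]. *)
  suff <- : dotmx (row i U *m A) (row i U) = d 0 i by [].
  rewrite [X in dotmx (_ *m X)]defA !mulmxA -row_mul (unitarymxP uU).
  rewrite -row_mul mul1mx row_diag_mx -scalemxAl -rowE linearZl_LR /=.
  by rewrite (row_unitarymxP uU) eqxx mulr1.
exists (U^t* *m diag_mx (map_mx sqrtC d)).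
rewrite adjmxM trmxCK tr_diag_mx map_diag_mx !mulmxA.
rewrite -[_ *m _ *m diag_mx _]mulmxA.
rewrite mulmx_diag [LHS]defA; congr (_ *m diag_mx _ *m _).
apply/rowP => i; rewrite !mxE -normCK ger0_norm ?sqrtC_ge0 //.
by rewrite sqrtCK.
Qed.

Lemma psdmxD A B : psdmx A -> psdmx B -> psdmx (A + B).
Proof.
move=> [/hermsymmxP hA A0] [/hermsymmxP hB B0].
split; first by apply/hermsymmxP; rewrite adjmxD hA hB.
by move=> u; rewrite mulmxDr linearDl /= addr_ge0.
Qed.

Lemma psdmx_congr X A : psdmx A -> psdmx (X *m A *m X^t*).
Proof.
by case/psdmx_sqrt=> B ->; rewrite !mulmxA -mulmxA -adjmxM; exact: psdmx_mul_adj.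
Qed.

Lemma psdmx_trace_ge0 A B : psdmx A -> psdmx B -> 0 <= \tr (A *m B).
Proof.
move=> /psdmx_sqrt[D ->] /psdmx_sqrt[E ->].
rewrite -mulmxA mxtrace_mulC -!mulmxA mulmxA -[E^t* *m D]trmxCK adjmxM trmxCK.
exact: mxtrace_mul_adj_ge0.
Qed.

(** With [A = D *m D^t*] and [B = E *m E^t*], the trace is the squared norm of [D^t* *m E], a factor
    in the middle of [A *m B]. *)
Lemma psdmx_trace_eq0 A B :
  psdmx A -> psdmx B -> \tr (A *m B) = 0 -> A *m B = 0.
Proof.
move=> /psdmx_sqrt[D ->] /psdmx_sqrt[E ->].
rewrite -mulmxA mxtrace_mulC -!mulmxA mulmxA -[E^t* *m D]trmxCK adjmxM trmxCK.
move/mxtrace_mul_adj_eq0; rewrite [D^t* *m (E *m _)]mulmxA => ->.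
by rewrite mul0mx mulmx0.
Qed.

(** * Orthogonal projections and supports *)

Lemma proj_ortho_herm m (U : 'M[C]_(m, n)) : (proj_ortho U)^t* = proj_ortho U.
Proof.
set P := proj_ortho U.
(* The rows of [1%:M - P] are orthogonal to those of [P], so [(1%:M - P) *m P^t* = 0]; the
   right-hand side is self-adjoint. *)
have P1 : P^t* = P *m P^t*.
  apply/eqP; rewrite -subr_eq0 -{1}[P^t*]mul1mx -mulmxBl -orthomx1E.
  have := proj_ortho_compl_sub U (1%:M : 'M_n).
  rewrite mul1mx -/P => /submx_trans.
  by apply; rewrite submx_ortho proj_orthoE.
by rewrite [LHS]P1 -[in RHS](trmxCK P) [in RHS]P1 (adjmxM P) trmxCK.
Qed.

Lemma proj_ortho_unique m (U : 'M[C]_(m, n)) P :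
  (P <= U)%MS -> (1%:M - P <= U^!)%MS -> proj_ortho U = P.
Proof.
move=> PU P'U; rewrite -[LHS]mul1mx -[X in X *m _](subrK P) mulmxDl.
by rewrite proj_ortho_0 // proj_ortho_id // add0r.
Qed.

Lemma psdmx_proj_ortho m (U : 'M[C]_(m, n)) : psdmx (proj_ortho U).
Proof. by rewrite -proj_ortho_proj -{2}proj_ortho_herm; exact: psdmx_mul_adj. Qed.

(** An eigenvector [v] for [d != 0] is [d^-1 *: (v *m A)]; conversely, the spectral decomposition
    writes the rows of [A] in eigenvectors with non-zero eigenvalue. *)
Lemma supportmxE A : A \is hermsymmx -> (supportmx A :=: A)%MS.
Proof.
move=> hA; have /orthomx_spectralP := hermitian_normalmx hA.
set U := spectralmx A; set d := spectral_diag A => defA.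
have uU : U \in unitmx := spectral_unit A.
apply/eqmxP/andP; split.
  apply/sumsmx_subP => i di; apply/rV_subP => v /eigenspaceP vA.
  by rewrite -(scalerK di v) -vA scalemx_sub // submxMl.
rewrite {1}defA -mulmxA mulmx_sub //; apply/row_subP => i.
rewrite row_mul row_diag_mx -scalemxAl -rowE.
have [->|di] := eqVneq (d 0 i) 0; first by rewrite scale0r sub0mx.
rewrite scalemx_sub //; apply: (sumsmx_sup i) => //; apply/eigenspaceP.
rewrite [X in _ *m X]defA !mulmxA -row_mul mulmxV // -row_mul mul1mx.
by rewrite row_diag_mx -scalemxAl -rowE.
Qed.

End PositiveMatrices.

(** * Shorted operators and the reduction of a USDM to a subspace *)

Section Reduction.
Local Open Scope sesquilinear_scope.
Variables (C : numClosedFieldType) (n : nat).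
Implicit Types (A B D E F G P Z rho : 'M[C]_n).

(* Writing E = B B^*, the witness is D = B Q B^* with Q the orthogonal
   projection onto the row space of P B; E - D is the short (generalized Schur
   complement) of E. *)
Lemma psdmx_short E P : psdmx E -> P^t* = P ->
  exists Z, let D := E *m P *m Z in
    [/\ psdmx D, psdmx (E - D) & P *m D = P *m E].
Proof.
case/psdmx_sqrt=> B -> hP; pose Q := proj_ortho (P *m B).
have hQ : Q^t* = Q := proj_ortho_herm _.
have idQ : Q *m Q = Q := proj_ortho_proj _.
have psdQ : psdmx Q := psdmx_proj_ortho _.
have PBQ : P *m B *m Q = P *m B by exact: proj_ortho_id.
(* Writing [Q = Y *m (P *m B)] makes [D] factor through [E *m P], so whatever annihilates [E *m P]
   on the left annihilates [D]. *)
have /submxP[Y defQ] : (Q <= P *m B)%MS by rewrite proj_orthoE.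
clearbody Q; have BPQ : B^t* *m P *m Y^t* = Q by rewrite -hQ defQ !adjmxM hP.
exists (Y^t* *m B^t*) => /=.
have -> : B *m B^t* *m P *m (Y^t* *m B^t*) = B *m Q *m B^t*.
  by rewrite -BPQ !mulmxA.
split.
- exact: psdmx_congr.
- rewrite -[X in X *m B^t* - _]mulmx1 -mulmxBl -mulmxBr; apply: psdmx_congr.
  have -> : 1%:M - Q = (1%:M - Q) *m (1%:M - Q)^t*.
    rewrite adjmxB trmx1 map_mx1 hQ mulmxBl mul1mx mulmxBr mulmx1.
    by rewrite idQ subrr subr0.
  exact: psdmx_mul_adj.
- by rewrite !mulmxA PBQ.
Qed.

Lemma proj_ortho1 : proj_ortho (1%:M : 'M[C]_n) = 1%:M.
Proof. by apply: proj_ortho_unique; rewrite ?subrr ?sub0mx. Qed.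

Lemma usdmP m (W : 'M[C]_(m, n)) rho1 rho2 Fq F1 F2 :
  usdm W rho1 rho2 Fq F1 F2 <->
  [/\ operator_on W Fq /\ psdmx Fq, operator_on W F1 /\ psdmx F1,
      operator_on W F2 /\ psdmx F2, Fq + F1 + F2 = proj_ortho W
    & \tr (rho1 *m F2) = 0 /\ \tr (rho2 *m F1) = 0].
Proof.
rewrite /usdm /povm !big_cons big_nil addr0 addrA; split.
  by case=> -[hF sumF] tr1 tr2; split; rewrite ?sumF //;
    apply: hF; rewrite !inE eqxx ?orbT.
case=> hq h1 h2 sumF [tr1 tr2]; split=> //; split=> // F.
by rewrite !inE => /or3P[] /eqP->.
Qed.

Lemma operator_on_herm m (W : 'M[C]_(m, n)) F :
  F^t* = F -> proj_ortho W *m F = F -> operator_on W F.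
Proof.
move=> hF WF; rewrite /operator_on WF -{1}hF -[proj_ortho W]proj_ortho_herm.
by rewrite -adjmxM WF hF.
Qed.

(** By cyclicity of the trace, the projections around [rho] can be moved onto [F], which absorbs
    them. *)
Lemma mxtrace_compress m (W : 'M[C]_(m, n)) a rho F : operator_on W F ->
  \tr (a *: (proj_ortho W *m rho *m proj_ortho W) *m F) = a * \tr (rho *m F).
Proof.
move=> opF; rewrite -[in RHS]opF -scalemxAl mxtraceZ; congr (_ * _).
rewrite -[_ *m _ *m _ *m F]mulmxA -[_ *m rho *m _]mulmxA mxtrace_mulC.
by rewrite -!(mulmxA rho).
Qed.

Lemma failure_compress m (W : 'M[C]_(m, n)) rho1 rho2 p1 p2 a1 a2 b F :
    operator_on W F -> a1 != 0 -> a2 != 0 -> b != 0 ->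
  let Pi := proj_ortho W in
  failure rho1 rho2 p1 p2 F =
    b * failure (a1^-1 *: (Pi *m rho1 *m Pi)) (a2^-1 *: (Pi *m rho2 *m Pi))
                (a1 * p1 / b) (a2 * p2 / b) F.
Proof.
move=> opF a1_neq0 a2_neq0 b_neq0 Pi; rewrite /failure !mxtrace_compress //.
by field; rewrite a1_neq0 a2_neq0 b_neq0.
Qed.

Lemma psdmx_herm F : psdmx F -> F^t* = F.
Proof. by case=> /hermsymmxP. Qed.

Lemma adjmx_mul0 A B : A^t* = A -> B^t* = B -> A *m B = 0 -> B *m A = 0.
Proof.
by move=> hA hB AB0; rewrite -hA -hB -adjmxM AB0 trmx0 (map_mx0 Num.conj).
Qed.

(* Since P1 *m Gq *m P2 = 0, the two shorts of Gq along P1 and P2 can be taken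
   one after the other; what is removed from Gq is given to G1 and G2. *)
Lemma usdm_reduction m (W : 'M[C]_(m, n)) P1 P2 rho1 rho2 Gq G1 G2 :
    psdmx rho1 -> psdmx rho2 -> P1^t* = P1 -> P2^t* = P2 ->
    P1 *m P1 = P1 -> P2 *m P2 = P2 -> P1 *m P2 = 0 ->
    rho1 *m P1 = 0 -> rho2 *m P2 = 0 -> (P1 <= rho2)%MS -> (P2 <= rho1)%MS ->
    proj_ortho W = 1%:M - P1 - P2 ->
    usdm (1%:M : 'M_n) rho1 rho2 Gq G1 G2 ->
  exists Gq' G1' G2', usdm W rho1 rho2 Gq' G1' G2' /\ psdmx (Gq - Gq').
Proof.
move=> psd1 psd2 hP1 hP2 idP1 idP2 P12 r1P1 r2P2 /submxP[X1 defP1].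
move=> /submxP[X2 defP2] defW /usdmP[[_ psdq] [_ psdG1] [_ psdG2]].
rewrite proj_ortho1 => sumG [tr1 tr2].
have r1G2 := psdmx_trace_eq0 psd1 psdG2 tr1.
have r2G1 := psdmx_trace_eq0 psd2 psdG1 tr2.
have P1G1 : P1 *m G1 = 0 by rewrite defP1 -mulmxA r2G1 mulmx0.
have P2G2 : P2 *m G2 = 0 by rewrite defP2 -mulmxA r1G2 mulmx0.
have G1P1 := adjmx_mul0 hP1 (psdmx_herm psdG1) P1G1.
have G2P2 := adjmx_mul0 hP2 (psdmx_herm psdG2) P2G2.
have P21 := adjmx_mul0 hP1 hP2 P12.
have defGq : Gq = 1%:M - G1 - G2 by rewrite -sumG addrAC addrK addrK.
have mulGq A B : A *m Gq *m B = A *m B - A *m G1 *m B - A *m G2 *m B.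
  by rewrite defGq !mulmxBr !mulmxBl mulmx1.
have [Z2] := psdmx_short psdq hP2.
set D2 := Gq *m P2 *m Z2 => -[psdD2 psdE P2D2].
(* [D2] starts with [Gq *m P2], and expanding [Gq = 1%:M - G1 - G2] gives [P1 *m Gq *m P2 = 0];
   likewise with [rho2] in place of [P1]. *)
have P1D2 : P1 *m D2 = 0.
  rewrite /D2 !mulmxA mulGq P12 P1G1 -[_ *m G2 *m _]mulmxA G2P2.
  by rewrite mul0mx mulmx0 !subr0 mul0mx.
have r2D2 : rho2 *m D2 = 0.
  rewrite /D2 !mulmxA mulGq r2P2 r2G1 -[_ *m G2 *m _]mulmxA G2P2.
  by rewrite mul0mx mulmx0 !subr0 mul0mx.
have D2P1 := adjmx_mul0 hP1 (psdmx_herm psdD2) P1D2.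
(* The second short is that of [Gq - D2]; since [D2] and [P1] annihilate each other, [D1] has the
   same form as for [Gq] itself. *)
have [Z1] := psdmx_short psdE hP1.
rewrite mulmxBl D2P1 subr0 mulmxBr P1D2 subr0.
set D1 := Gq *m P1 *m Z1 => -[psdD1 psdq' P1D1].
have P2D1 : P2 *m D1 = 0.
  rewrite /D1 !mulmxA mulGq P21 P2G2 -[_ *m G1 *m _]mulmxA G1P1.
  by rewrite mul0mx mulmx0 !subr0 mul0mx.
have r1D1 : rho1 *m D1 = 0.
  rewrite /D1 !mulmxA mulGq r1P1 r1G2 -[_ *m G1 *m _]mulmxA G1P1.
  by rewrite mul0mx mulmx0 !subr0 mul0mx.
have onW F : psdmx F -> P1 *m F = 0 -> P2 *m F = 0 -> operator_on W F.
  move=> psdF P1F P2F; apply: operator_on_herm; first exact: psdmx_herm.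
  by rewrite defW !mulmxBl mul1mx P1F P2F !subr0.
(* Positivity despite the term [- P]: an operator on [W] equals its compression to [W], and this
   compression turns [G - P + D] into that of [G + D]. *)
have outcome G P D : psdmx G -> psdmx D -> P^t* = P ->
    proj_ortho W *m P = 0 -> P1 *m (G - P + D) = 0 -> P2 *m (G - P + D) = 0 ->
  operator_on W (G - P + D) /\ psdmx (G - P + D).
  move=> psdG psdD hP WP P1F P2F.
  have opF : operator_on W (G - P + D).
    apply: operator_on_herm.
      by rewrite adjmxD adjmxB hP !psdmx_herm.
    by rewrite defW !mulmxBl mul1mx P1F P2F !subr0.
  split=> //; rewrite -opF addrAC mulmxBr WP subr0 -{2}proj_ortho_herm.
  by apply: psdmx_congr; exact: psdmxD.
exists (Gq - D2 - D1), (G1 - P2 + D2), (G2 - P1 + D1); split; last first.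
  have -> : Gq - (Gq - D2 - D1) = D2 + D1.
    by rewrite !opprB addrA addrC subrKA addrC.
  exact: psdmxD.
apply/usdmP; split.
- split=> //; apply: onW => //; rewrite !mulmxBr.
    by rewrite P1D2 P1D1 subr0 subrr.
  by rewrite P2D2 P2D1 subrr subr0.
- apply: outcome => //.
  + by rewrite defW !mulmxBl mul1mx P12 idP2 subr0 subrr.
  + by rewrite mulmxDr mulmxBr P1G1 P12 P1D2 subr0 addr0.
  (* Here [P2 *m D2 = P2 *m Gq = P2 - P2 *m G1], which cancels the other two terms. *)
  rewrite mulmxDr mulmxBr P2D2 idP2 defGq !mulmxBr mulmx1 P2G2 subr0.
  by rewrite subrKA subrr.
- apply: outcome => //.
  + by rewrite defW !mulmxBl mul1mx P21 idP1 subrr subr0.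
  + rewrite mulmxDr mulmxBr P1D1 idP1 defGq !mulmxBr mulmx1 P1G1 subr0.
    by rewrite subrKA subrr.
  + by rewrite mulmxDr mulmxBr P2G2 P21 P2D1 subr0 addr0.
- rewrite defW -sumG; apply/matrixP => i j; rewrite !mxE.
  ring.
- split.
    by rewrite mulmxDr mulmxBr r1G2 r1P1 r1D1 subr0 addr0 mxtrace0.
  by rewrite mulmxDr mulmxBr r2G1 r2P2 r2D2 subr0 addr0 mxtrace0.
Qed.

Lemma failure_le rho1 rho2 (p1 p2 : C) F G :
    psdmx rho1 -> psdmx rho2 -> 0 <= p1 -> 0 <= p2 -> psdmx (G - F) ->
  failure rho1 rho2 p1 p2 F <= failure rho1 rho2 p1 p2 G.
Proof.
move=> psd1 psd2 p1_ge0 p2_ge0 psdGF.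
by rewrite lerD // ler_wpM2l // -subr_ge0 -linearB -mulmxBr psdmx_trace_ge0.
Qed.

End Reduction.

(** * The projection onto [H'], and the transfer of optimality *)

Lemma proj_ortho_compl (C : numClosedFieldType) n (U V : 'M[C]_n) :
    (U <= V^!)%MS ->
  proj_ortho (U + V)^!%MS = 1%:M - proj_ortho U - proj_ortho V.
Proof.
move=> UV; have VU : (V <= U^!)%MS by rewrite orthomx_sym.
apply: proj_ortho_unique; last first.
  rewrite ortho_id -addrA -opprD opprB addrC subrK.
  by rewrite addmx_sub_adds ?proj_orthoE.
have compl_sub W : (1%:M - proj_ortho W <= (W : 'M[C]_n)^!)%MS.
  by have := proj_ortho_compl_sub W (1%:M : 'M_n); rewrite mul1mx.
rewrite orthomx_sym addsmx_sub; apply/andP; split; rewrite orthomx_sym.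
  by rewrite addmx_sub ?compl_sub // eqmx_opp proj_orthoE.
by rewrite addrAC addmx_sub ?compl_sub // eqmx_opp proj_orthoE.
Qed.

Theorem theorem2 (R : realType) (n r1 r2 : nat)
    (rho1 rho2 : 'M[R[i]]_n) (p1 p2 : R[i])
    (hrho1 : density rho1) (hrho2 : density rho2)
    (hr1 : \rank rho1 = r1) (hr2 : \rank rho2 = r2)
    (hp1 : 0 <= p1) (hp2 : 0 <= p2) (hp : p1 + p2 = 1)
    (hsum : (supportmx rho1 + supportmx rho2 :=: 1%:M)%MS)
    (hcap : (supportmx rho1 :&: supportmx rho2 = 0)%MS) :
  let S1 := ((supportmx rho1)^! :&: supportmx rho2)%MS in
  let S2 := ((supportmx rho2)^! :&: supportmx rho1)%MS in
  let H' := ((S1 + S2)%MS^!)%MS in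
  let Pi := proj_ortho H' in
  let N1 := \tr (rho1 *m Pi) in
  let N2 := \tr (rho2 *m Pi) in
  let N := N1 * p1 + N2 * p2 in
  let rho1' := N1^-1 *: (Pi *m rho1 *m Pi) in
  let rho2' := N2^-1 *: (Pi *m rho2 *m Pi) in
  let p1' := N1 * p1 / N in
  let p2' := N2 * p2 / N in
  [/\ (S1 <= S2^!)%MS,
      (H'^! :=: S1 + S2)%MS /\ (S1 :&: S2 = 0)%MS,
      (H' + H'^! :=: 1%:M)%MS /\ (H' :&: H'^! = 0)%MS
    & 0 < N1 -> 0 < N2 ->
      forall Fq' F1' F2' : 'M[R[i]]_n,
        optimal_usdm H' rho1' rho2' p1' p2' Fq' F1' F2' ->
        let F1 := F1' + proj_ortho S2 in
        let F2 := F2' + proj_ortho S1 in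
        let Fq := Fq' in
        optimal_usdm (1%:M : 'M_n) rho1 rho2 p1 p2 Fq F1 F2 /\
        failure rho1 rho2 p1 p2 Fq = N * failure rho1' rho2' p1' p2' Fq'].
Proof.
move=> S1 S2 H' Pi N1 N2 N rho1' rho2' p1' p2'.
have [psd1 tr1] := hrho1; have [psd2 tr2] := hrho2.
have supp1 := supportmxE psd1.1; have supp2 := supportmxE psd2.1.
have S1orth : (S1 <= (supportmx rho1)^!)%MS := capmxSl _ _.
have S2orth : (S2 <= (supportmx rho2)^!)%MS := capmxSl _ _.
have S1sub : (S1 <= supportmx rho2)%MS := capmxSr _ _.
have S2sub : (S2 <= supportmx rho1)%MS := capmxSr _ _.
clearbody S1 S2; have S12 : (S1 <= S2^!)%MS.
  by apply: submx_trans S1sub _; rewrite orthomx_sym.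
split; first exact: S12.
- by split; [exact: ortho_id | exact: orthomx_disj].
- by split; [exact: addsmx_ortho | exact: orthomx_ortho_disj].
move=> N1_gt0 N2_gt0 Fq' F1' F2' [usdmF' optF'] F1 F2 Fq.
have /usdmP[onq on1 on2 sumF' [tr1' tr2']] := usdmF'.
pose P1 := proj_ortho S1; pose P2 := proj_ortho S2.
have defPi : Pi = 1%:M - P1 - P2 := proj_ortho_compl S12.
have r1P1 : rho1 *m P1 = 0.
  apply: proj_ortho_0; rewrite orthomx_sym; apply: submx_trans S1orth _.
  by rewrite submx_ortho supp1.
have r2P2 : rho2 *m P2 = 0.
  apply: proj_ortho_0; rewrite orthomx_sym; apply: submx_trans S2orth _.
  by rewrite submx_ortho supp2.
have P1r2 : (P1 <= rho2)%MS by rewrite proj_orthoE -supp2.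
have P2r1 : (P2 <= rho1)%MS by rewrite proj_orthoE -supp1.
have P12 : P1 *m P2 = 0 by apply: proj_ortho_0; rewrite proj_orthoE.
have N1_neq0 : N1 != 0 by rewrite gt_eqF.
have N2_neq0 : N2 != 0 by rewrite gt_eqF.
(* If [N] vanished, both priors would, against [p1 + p2 = 1]. *)
have N_gt0 : 0 < N.
  have N_ge0 : 0 <= N by rewrite addr_ge0 ?mulr_ge0 // ltW.
  rewrite lt_def N_ge0 andbT /N.
  rewrite paddr_eq0 ?mulr_ge0 ?(ltW N1_gt0) ?(ltW N2_gt0) //.
  rewrite !mulf_eq0 (negPf N1_neq0) (negPf N2_neq0) /=.
  apply/negP => /andP[/eqP p10 /eqP p20].
  by move: hp; rewrite p10 p20 addr0 => /eqP; rewrite eq_sym oner_eq0.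
have N_neq0 : N != 0 by rewrite gt_eqF.
(* On operators of [H'] the two failure probabilities differ only by the factor [N], so they are
   minimized together. *)
have failureE F : operator_on H' F ->
    failure rho1 rho2 p1 p2 F = N * failure rho1' rho2' p1' p2' F.
  by move=> opF; exact: failure_compress.
split; last exact: failureE onq.1.
have op1 F : operator_on (1%:M : 'M_n) F.
  by rewrite /operator_on proj_ortho1 mul1mx mulmx1.
split.
  apply/usdmP; split.
  - by split; [exact: op1 | exact: onq.2].
  - split; first exact: op1.
    by apply: psdmxD on1.2 _; exact: psdmx_proj_ortho.
  - split; first exact: op1.
    by apply: psdmxD on2.2 _; exact: psdmx_proj_ortho.
  - rewrite proj_ortho1 addrA [Fq + _]addrA -[_ + proj_ortho S2 + _]addrA.
    rewrite [proj_ortho S2 + _]addrC addrA sumF' -/Pi defPi.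
    by rewrite -/P1 -/P2 !subrK.
  split.
    (* The added projection is invisible to [rho1], and the reduced condition is the original one up
       to the non-zero factor [N1^-1]. *)
    rewrite mulmxDr r1P1 addr0.
    by move/eqP: tr1'; rewrite (mxtrace_compress _ _ on2.1) mulf_eq0
      invr_eq0 (negPf N1_neq0) => /eqP.
  rewrite mulmxDr r2P2 addr0.
  by move/eqP: tr2'; rewrite (mxtrace_compress _ _ on1.1) mulf_eq0
    invr_eq0 (negPf N2_neq0) => /eqP.
(* Optimality: an arbitrary competitor is replaced by one on [H'] that fails no more often, and the
   comparison is then made in the reduced problem. *)
move=> Gq G1 G2 usdmG.
have [Gq' [G1' [G2' [usdmG' le_G]]]] := usdm_reduction psd1 psd2
  (proj_ortho_herm _) (proj_ortho_herm _) (proj_ortho_proj _) (proj_ortho_proj _)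
  P12 r1P1 r2P2 P1r2 P2r1 defPi usdmG.
apply: le_trans (failure_le psd1 psd2 hp1 hp2 le_G).
have [onGq onG1 onG2 sumG [trG1 trG2]] := (usdmP _ _ _ _ _ _).1 usdmG'.
rewrite (failureE _ onq.1) (failureE _ onGq.1) (ler_pM2l N_gt0).
apply: (optF' Gq' G1' G2'); apply/usdmP; split; [exact: onGq | exact: onG1
  | exact: onG2 | exact: sumG |].
rewrite (mxtrace_compress _ _ onG2.1) (mxtrace_compress _ _ onG1.1).
by rewrite trG1 trG2 !mulr0.
Qed.
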